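(* The nonlinear evolution equation $$w_t = w_{xxx} - 3\,\frac{w_x w_{xx}}{w}$$ is linked to the modified Korteweg–de Vries (mKdV) equation $$v_t = v_{xxx} - 6 v^2 v_x$$ via the Cole–Hopf transformation $$vw - w_x = 0 .$$
   Context: The unknowns $w$ and $v$ depend on the real variables $(x,t)$, and subscripts denote partial derivatives. For each fixed $t$ the unknowns are taken in a manifold $M$ modeled on a linear topological space (the same $M$ for both equations), whose tangent fibers are identified with $M$ itself. It is generally assumed that $M$ is the space of functions of $(x,t)$ which, for each fixed $t$, belong to the Schwartz space of rapidly decreasing functions on $\mathbb R$. Two evolution equations $u_t=K(u)$ and $v_t=G(v)$ are linked via $B(u,v)=0$ when this relation is a Bäcklund transformation between them, in the following sense: whenever two solutions $u(x,t)$ and $v(x,t)$ of the respective equations are given such that $B(u(x,t),v(x,t))|_{t=0}=0$, it follows that $B(u(x,t),v(x,t))|_{t=\bar t}=0$ for all $\bar t>0$ and all $x\in\mathbb R$. Solutions of the two equations are then said to be connected via the Bäcklund transformation, which establishes a correspondence between them. Here $B(w,v)=vw-w_x$. *)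

(* Defs.v *)
From Stdlib Require Import Reals.
From Coquelicot Require Import Coquelicot.
Open Scope R_scope.

(* Functions of (x,t) are applied as u x t. *)
Definition slice (u : R -> R -> R) (t : R) : R -> R := fun x => u x t.

Definition smooth (f : R -> R) : Prop := forall n x, ex_derive_n f n x.

(* A space of smooth functions on R is given by the set of the pairs (k,n) for
   which the seminorm  p_{k,n} f = sup_x |x^k f^(n)(x)|  is required to be
   finite; its topology is the one defined by these seminorms. *)
Definition fspace := nat -> nat -> Prop.

Definition belongs (M : fspace) (f : R -> R) : Prop :=
  smooth f /\
  forall k n, M k n -> exists C, forall x, Rabs (x ^ k * Derive_n f n x) <= C.

(* t |-> u(.,t) is a continuous curve in M for t >= 0. *)
Definition curve (M : fspace) (u : R -> R -> R) : Prop :=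
  (forall t, 0 <= t -> belongs M (slice u t)) /\
  (forall k n, M k n -> forall t, 0 <= t -> forall eps, 0 < eps ->
   exists delta, 0 < delta /\
     forall s, 0 <= s -> Rabs (s - t) < delta ->
     forall x, Rabs (x ^ k * (Derive_n (slice u s) n x - Derive_n (slice u t) n x))
               <= eps).

Definition schwartz : fspace := fun _ _ => True.

(* The smooth functions f such that f' is a Schwartz function.  Such an f is
   bounded, and the sup norm of f completes the topology.  A nonvanishing w
   with w_x = v w and v Schwartz has nonzero limits at -oo and +oo: it is in
   this space, and never in [schwartz]. *)
Definition schwartz_derivative : fspace := fun k n => (1 <= n)%nat \/ k = 0%nat.

(* The right-hand side K of an evolution equation u_t = K(u), together with
   the functions at which K is defined. *)
Record evolution := Evolution {
  dom : (R -> R) -> Prop;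
  rhs : (R -> R) -> R -> R
}.

Definition solution (M : fspace) (E : evolution) (u : R -> R -> R) : Prop :=
  curve M u /\
  (forall t, 0 <= t -> dom E (slice u t)) /\
  (forall x t, 0 < t -> is_derive (fun s => u x s) t (rhs E (slice u t) x)).

(* Mu and Mv are the spaces in which u and v are taken. *)
Definition linked (Mu Mv : fspace) (K G : evolution)
    (B : (R -> R) -> (R -> R) -> R -> R) : Prop :=
  forall u v : R -> R -> R,
    solution Mu K u -> solution Mv G v ->
    (forall x, B (slice u 0) (slice v 0) x = 0) ->
    forall tbar, 0 < tbar -> forall x, B (slice u tbar) (slice v tbar) x = 0.

Definition cole_hopf_source : evolution :=
  Evolution
    (fun w => forall x, w x <> 0)
    (fun w x => Derive_n w 3 x - 3 * (Derive w x * Derive_n w 2 x / w x)).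

Definition mkdv : evolution :=
  Evolution
    (fun _ => True)
    (fun v x => Derive_n v 3 x - 6 * v x ^ 2 * Derive v x).

Definition cole_hopf (w v : R -> R) (x : R) : R := v x * w x - Derive w x.

(* Main.v *)
(* If [w] solves the first equation, [p = w_x / w] formally solves mKdV, so the
   claim is uniqueness for mKdV.  It is proved for primitives, which avoids
   differentiating [w_x] in [t]: with [V_x = v] and [V_t = v_xx - 2 v^3], the
   function [eta = V - (1/2) ln (w^2)], normalized to vanish at [t = 0],
   satisfies [eta_t = eta_xxx - 2 a eta_x] with [a = v^2 + v p + p^2].  The energy
   of [eta] on [[-L, L]] obeys a Gronwall inequality with a boundary term
   [O(1/L)]; letting [L] tend to infinity gives [eta = 0].  The bounds on [p]
   need [w] to stay away from [0] uniformly on [R x [0, T]]: [w^2] has nonzero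
   limits at infinity when [t = 0], and these are conserved.  The argument uses
   no decay of [w] itself, so it covers both spaces. *)
Require Import Defs.
From Stdlib Require Import Reals Lra Lia ClassicalEpsilon.
From Coquelicot Require Import Coquelicot.
Open Scope R_scope.

(** * Joint continuity in space and time *)

Definition cont2 (f : R -> R -> R) : Prop := forall x t, continuity_2d_pt f x t.

Lemma cont2_space (f : R -> R -> R) (t x : R) :
  cont2 f -> continuous (fun y => f y t) x.
Proof.
intros Hf. apply continuity_pt_filterlim. intros e He.
destruct (Hf x t (mkposreal e He)) as [d Hd].
exists d; split; [apply cond_pos|].
intros y [_ Hy]. apply Hd; [exact Hy|].
rewrite Rminus_diag, Rabs_R0; apply cond_pos.
Qed.

Lemma cont2_swap (f : R -> R -> R) : cont2 f -> cont2 (fun t x => f x t).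
Proof.
intros Hf t x e. destruct (Hf x t e) as [d Hd]. exists d; intros; now apply Hd.
Qed.

Lemma cont2_time (f : R -> R -> R) (x t : R) : cont2 f -> continuous (f x) t.
Proof. intros Hf. exact (cont2_space _ x t (cont2_swap f Hf)). Qed.

Lemma cont2_plus (f g : R -> R -> R) :
  cont2 f -> cont2 g -> cont2 (fun x t => f x t + g x t).
Proof. intros Hf Hg x t. now apply continuity_2d_pt_plus. Qed.

Lemma cont2_minus (f g : R -> R -> R) :
  cont2 f -> cont2 g -> cont2 (fun x t => f x t - g x t).
Proof. intros Hf Hg x t. now apply continuity_2d_pt_minus. Qed.

Lemma cont2_mult (f g : R -> R -> R) :
  cont2 f -> cont2 g -> cont2 (fun x t => f x t * g x t).
Proof. intros Hf Hg x t. now apply continuity_2d_pt_mult. Qed.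

Lemma cont2_const (c : R) : cont2 (fun _ _ => c).
Proof. intros x t. apply continuity_2d_pt_const. Qed.

Lemma cont2_inv (f : R -> R -> R) :
  (forall x t, f x t <> 0) -> cont2 f -> cont2 (fun x t => / f x t).
Proof. intros H0 Hf x t. now apply continuity_2d_pt_inv. Qed.

Lemma cont2_pow (f : R -> R -> R) (n : nat) :
  cont2 f -> cont2 (fun x t => f x t ^ n).
Proof.
intros Hf. induction n as [|n IH]; simpl; [apply cont2_const|].
now apply cont2_mult.
Qed.

(** The increment of [f] splits into a spatial one, controlled by the mean value theorem with a
    constant uniform in time, and a temporal one at the fixed point [x]. *)
Lemma cont2_of_bounded_derivative (f df : R -> R -> R) :
  (forall x t, is_derive (fun y => f y t) x (df x t)) ->
  (forall T, exists C, forall x t, t <= T -> Rabs (df x t) <= C) ->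
  (forall x t, continuous (f x) t) -> cont2 f.
Proof.
intros Hd HC Ht x t e. destruct (HC (t + 1)) as [C HC'].
set (K := Rabs C + 1).
assert (HK : 0 < K) by (unfold K; pose proof (Rabs_pos C); lra).
assert (He : 0 < e / 2) by (pose proof (cond_pos e); lra).
pose proof (proj2 (continuity_pt_filterlim (f x) t) (Ht x t)) as Hc.
destruct (Hc (e / 2) He) as [d [Hd0 Hd1]].
(* [d] handles the increment in time, [1] keeps [s] below [t + 1], where [C] bounds [df], and
   [e / 2 / K] handles the increment in space. *)
assert (Hm : 0 < Rmin (Rmin d 1) (e / 2 / K)).
{ repeat apply Rmin_glb_lt; try lra. now apply Rdiv_lt_0_compat. }
exists (mkposreal _ Hm). simpl. intros u s Hu Hs.
assert (Hu' : Rabs (u - x) < e / 2 / K) by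
  (eapply Rlt_le_trans; [exact Hu | apply Rmin_r]).
assert (Hs' : Rabs (s - t) < Rmin d 1) by
  (eapply Rlt_le_trans; [exact Hs | apply Rmin_l]).
assert (Hsd : Rabs (s - t) < d) by
  (eapply Rlt_le_trans; [exact Hs' | apply Rmin_l]).
assert (Hs1 : Rabs (s - t) < 1) by
  (eapply Rlt_le_trans; [exact Hs' | apply Rmin_r]).
apply Rabs_def2 in Hs1.
assert (H1 : Rabs (f x s - f x t) < e / 2).
{ destruct (Req_dec s t) as [->|Hst].
  - rewrite Rminus_diag, Rabs_R0. exact He.
  - apply (Hd1 s). split; [split; [exact I | auto] | exact Hsd]. }
destruct (MVT_gen (fun y => f y s) x u (fun y => df y s)) as [c [_ Hc2]].
{ intros; apply Hd. }
{ intros y _. apply continuity_pt_filterlim.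
  apply (ex_derive_continuous (fun y => f y s)). eexists; apply Hd. }
assert (H2 : Rabs (f u s - f x s) < e / 2).
{ rewrite Hc2, Rabs_mult.
  apply Rle_lt_trans with (K * Rabs (u - x)).
  - apply Rmult_le_compat_r; [apply Rabs_pos|].
    eapply Rle_trans; [apply HC'; lra|].
    unfold K. pose proof (Rle_abs C); lra.
  - replace (e / 2) with (K * (e / 2 / K)) by (field; lra).
    now apply Rmult_lt_compat_l. }
replace (f u s - f x t) with ((f u s - f x s) + (f x s - f x t)) by ring.
eapply Rle_lt_trans; [apply Rabs_triang|]. lra.
Qed.

(** * Integrals depending on a parameter *)

Lemma cont2_ex_RInt (f : R -> R -> R) (t a b : R) :
  cont2 f -> ex_RInt (fun x => f x t) a b.
Proof.
intros Hf. apply (ex_RInt_continuous (V := R_CompleteNormedModule)).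
intros z _. now apply cont2_space.
Qed.

(** On a compact segment, continuity at time [t] is uniform in [x], so the integrands at times [s]
    and [t] are uniformly close. *)
Lemma continuous_RInt_param (f : R -> R -> R) (a b t : R) :
  cont2 f -> continuous (fun s => RInt (fun x => f x s) a b) t.
Proof.
intros Hf. revert a b.
assert (Hle : forall a b, a <= b ->
  continuous (fun s => RInt (fun x => f x s) a b) t); cycle 1.
{ intros a b. destruct (Rle_dec a b) as [Hab|Hab]; [now apply Hle|].
  apply continuous_ext with (fun s => - RInt (fun x => f x s) b a).
  - intros s. apply (opp_RInt_swap (V := R_CompleteNormedModule)).
    now apply cont2_ex_RInt.
  - apply (continuous_opp (fun s => RInt (fun x => f x s) b a)).
    apply Hle; lra. }
intros a b Hab. apply continuity_pt_filterlim. intros e He.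
(* The summand 1 keeps the denominator positive when [a = b]. *)
assert (He' : 0 < e / (b - a + 1)) by (apply Rdiv_lt_0_compat; lra).
destruct (uniform_continuity_2d_1d f a b t (fun x _ => Hf x t)
            (mkposreal _ He')) as [d Hd].
exists d; split; [apply cond_pos|].
intros s [_ Hs]. simpl in Hs |- *. unfold R_dist in *.
apply Rabs_def2 in Hs.
assert (E : RInt (fun x => f x s) a b - RInt (fun x => f x t) a b =
            RInt (fun x => f x s - f x t) a b).
{ symmetry. apply (RInt_minus (V := R_CompleteNormedModule)
    (fun x => f x s) (fun x => f x t)); now apply cont2_ex_RInt. }
rewrite E.
apply Rle_lt_trans with ((b - a) * (e / (b - a + 1))).
- apply abs_RInt_le_const; [exact Hab| |].
  + apply (cont2_ex_RInt (fun x s => f x s - f x t) s).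
    apply cont2_minus; [exact Hf|]. intros x r e'.
    destruct (Hf x t e') as [d' Hd']. exists d'. intros u v Hu _.
    apply Hd'; [exact Hu|]. rewrite Rminus_diag, Rabs_R0; apply cond_pos.
  + intros x Hx. left. pose proof (cond_pos d). apply Hd; try lra.
    rewrite Rminus_diag, Rabs_R0. apply cond_pos.
- apply Rlt_le_trans with ((b - a + 1) * (e / (b - a + 1))).
  + apply Rmult_lt_compat_r; lra.
  + right; field; lra.
Qed.

Lemma is_derive_RInt_time (f g : R -> R -> R) (a b t : R) :
  0 < t -> cont2 f -> cont2 g ->
  (forall x s, 0 < s -> is_derive (f x) s (g x s)) ->
  is_derive (fun s => RInt (fun x => f x s) a b) t (RInt (fun x => g x t) a b).
Proof.
intros Ht Hf Hg Hd.
assert (Hloc : locally t (fun s => 0 < s)).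
{ apply open_gt. exact Ht. }
assert (E : RInt (fun x => g x t) a b =
            RInt (fun x => Derive (fun s => f x s) t) a b).
{ apply RInt_ext. intros x _. symmetry. now apply is_derive_unique, Hd. }
rewrite E.
apply (is_derive_RInt_param (fun s x => f x s)).
- revert Hloc. apply filter_imp. intros s Hs x _. eexists. now apply Hd.
- intros x _. apply continuity_2d_pt_ext_loc with (fun s x => g x s).
  + exists (mkposreal t Ht). simpl. intros s y Hs _.
    symmetry. apply is_derive_unique, Hd. apply Rabs_def2 in Hs. lra.
  + now apply cont2_swap.
- apply filter_forall. intros s. now apply cont2_ex_RInt.
Qed.

Lemma is_derive_RInt_upper (f : R -> R) (a x : R) :
  (forall y, continuous f y) -> is_derive (fun y => RInt f a y) x (f x).
Proof.
intros Hf. apply is_derive_RInt with a; [|apply Hf].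
apply filter_forall. intros y.
apply (RInt_correct (V := R_CompleteNormedModule)), ex_RInt_continuous.
intros; apply Hf.
Qed.

Lemma RInt_of_derivative (f df : R -> R) (a b : R) :
  (forall x, is_derive f x (df x)) -> (forall x, continuous df x) ->
  RInt df a b = f b - f a.
Proof.
intros Hd Hc. apply is_RInt_unique.
apply (is_RInt_derive (V := R_CompleteNormedModule) f df); intros; auto.
Qed.

(** * Compactness, decay and Gronwall estimates *)

(* Monotonicity in [d] lets the Lebesgue number of the cover by the balls of
   radius [d] serve as the uniform value. *)
Lemma uniform_on_segment (P : R -> R -> Prop) (a b : R) :
  (forall s d d', 0 < d' -> d' <= d -> P d s -> P d' s) ->
  (forall t, a <= t <= b -> exists d, 0 < d /\
     forall s, a <= s <= b -> Rabs (s - t) < d -> P d s) ->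
  exists d, 0 < d /\ forall s, a <= s <= b -> P d s.
Proof.
intros Hmon Hloc.
assert (Hc : forall t, exists d : posreal, a <= t <= b ->
  forall s, a <= s <= b -> Rabs (s - t) < d -> P d s).
{ intros t. destruct (excluded_middle_informative (a <= t <= b)) as [Ht|Ht].
  - destruct (Hloc t Ht) as [d [H0 Hd]]. now exists (mkposreal d H0).
  (* Outside the segment the radius is arbitrary; this only makes [delta] total. *)
  - exists (mkposreal 1 Rlt_0_1). now intros. }
pose (delta := fun t => proj1_sig (constructive_indefinite_description _ (Hc t))).
assert (Hdelta : forall t, a <= t <= b ->
  forall s, a <= s <= b -> Rabs (s - t) < delta t -> P (delta t) s).
{ intros t. unfold delta.
  now destruct (constructive_indefinite_description _ (Hc t)). }
destruct (compactness_value_1d a b delta) as [d Hd].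
exists d; split; [apply cond_pos|].
intros s Hs. apply NNPP. intros Hn. apply (Hd s Hs).
intros [t [Ht [Hst Hle]]]. apply Hn.
apply Hmon with (delta t); [apply cond_pos | exact Hle | now apply Hdelta].
Qed.

(** Since [atan] has derivative [1 / (1 + x ^ 2)], the function [f + C * atan] is nondecreasing and
    [f - C * atan] is nonincreasing. The factor 2 bounds [Rabs (atan x)], using [PI <= 4]. *)
Lemma bounded_of_integrable_derivative (f df : R -> R) (C : R) :
  (forall x, is_derive f x (df x)) ->
  (forall x, Rabs ((1 + x ^ 2) * df x) <= C) ->
  forall x, Rabs (f x - f 0) <= 2 * C.
Proof.
intros Hd HC x.
assert (HC0 : 0 <= C) by (eapply Rle_trans; [apply Rabs_pos | apply (HC 0)]).
assert (Hb : forall y, - (C / (1 + y ^ 2)) <= df y <= C / (1 + y ^ 2)).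
{ intros y. assert (Hp : 0 < 1 + y ^ 2) by (pose proof (pow2_ge_0 y); lra).
  specialize (HC y). rewrite Rabs_mult, (Rabs_pos_eq (1 + y ^ 2)) in HC by lra.
  apply Rabs_le_between. apply Rmult_le_reg_l with (1 + y ^ 2); [exact Hp|].
  replace ((1 + y ^ 2) * (C / (1 + y ^ 2))) with C by (field; lra). exact HC. }
assert (Hpi : forall y, - 2 < atan y < 2).
{ intros y. pose proof (atan_bound y). pose proof PI_4. lra. }
assert (Hder : forall s y, is_derive (fun z => f z + s * (C * atan z)) y
                  (df y + s * (C / (1 + y ^ 2)))).
{ intros s y. apply (is_derive_plus f (fun z => s * (C * atan z))); [apply Hd|].
  auto_derive; [exact I|]. unfold Rsqr. field. pose proof (pow2_ge_0 y); lra. }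
assert (Hmvt : forall s, exists c,
  f x - f 0 + s * C * atan x = (df c + s * (C / (1 + c ^ 2))) * x).
{ intros s.
  destruct (MVT_gen (fun z => f z + s * (C * atan z)) 0 x
              (fun y => df y + s * (C / (1 + y ^ 2)))) as [c [_ Hc]].
  - intros; apply Hder.
  - intros y _. apply continuity_pt_filterlim.
    apply (ex_derive_continuous (fun z => f z + s * (C * atan z))).
    eexists; apply Hder.
  - exists c. rewrite atan_0, Rminus_0_r in Hc. lra. }
(* The two signs give the two monotone functions, hence the two sides of the bound. *)
destruct (Hmvt 1) as [c1 H1]. destruct (Hmvt (-1)) as [c2 H2].
destruct (Hb c1) as [Hb1 Hb1']. destruct (Hb c2) as [Hb2 Hb2'].
destruct (Hpi x) as [Hp1 Hp2].
assert (HA : - (2 * C) <= C * atan x <= 2 * C) by nra.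
apply Rabs_le_between.
destruct (Rle_dec 0 x) as [Hx|Hx].
- assert (0 <= (df c1 + 1 * (C / (1 + c1 ^ 2))) * x) by (apply Rmult_le_pos; lra).
  assert (0 <= - (df c2 + -1 * (C / (1 + c2 ^ 2))) * x) by (apply Rmult_le_pos; lra).
  lra.
- assert (0 <= (df c1 + 1 * (C / (1 + c1 ^ 2))) * - x) by (apply Rmult_le_pos; lra).
  assert (0 <= - (df c2 + -1 * (C / (1 + c2 ^ 2))) * - x) by (apply Rmult_le_pos; lra).
  lra.
Qed.

(** Nonnegativity squeezes the integral over every segment from 0 to 0, and [g] is the derivative of
    that vanishing integral. *)
Lemma nonneg_RInt_zero (g : R -> R) :
  (forall x, continuous g x) -> (forall x, 0 <= g x) ->
  (forall L, 1 <= L -> RInt g (- L) L <= 0) -> forall x, g x = 0.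
Proof.
intros Hc Hg HI x.
assert (Hex : forall a b, ex_RInt g a b).
{ intros. apply (ex_RInt_continuous (V := R_CompleteNormedModule)); auto. }
assert (Hpos : forall a b, a <= b -> 0 <= RInt g a b).
{ intros. apply RInt_ge_0; auto. }
assert (H0 : forall y, RInt g 0 y = 0).
{ intros y. set (L := Rabs y + 1).
  assert (HL : 1 <= L) by (unfold L; pose proof (Rabs_pos y); lra).
  assert (Hy : - L <= y <= L).
  { apply Rabs_le_between. unfold L; lra. }
  pose proof (HI L HL) as H.
  pose proof (RInt_Chasles g (- L) y L (Hex _ _) (Hex _ _)) as E1.
  pose proof (RInt_Chasles g (- L) 0 L (Hex _ _) (Hex _ _)) as E2.
  pose proof (RInt_Chasles g (- L) 0 y (Hex _ _) (Hex _ _)) as E3.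
  unfold plus in E1, E2, E3; simpl in E1, E2, E3.
  pose proof (Hpos (- L) y ltac:(lra)). pose proof (Hpos y L ltac:(lra)).
  pose proof (Hpos (- L) 0 ltac:(lra)). pose proof (Hpos 0 L ltac:(lra)).
  lra. }
transitivity (Derive (fun y => RInt g 0 y) x).
{ symmetry. apply is_derive_unique. now apply is_derive_RInt_upper. }
rewrite (Derive_ext (fun y => RInt g 0 y) (fun _ => 0) x H0).
apply Derive_const.
Qed.

(** The integrating factor [exp (- K * t)] leaves a derivative of at most [e]; one application of
    the mean value theorem on [[0, T]] then suffices, with mere continuity at 0. *)
Lemma gronwall (E dE : R -> R) (K e T : R) :
  0 <= K -> 0 <= e -> 0 < T ->
  (forall t, continuous E t) ->
  (forall t, 0 < t -> is_derive E t (dE t)) ->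
  (forall t, 0 <= t <= T -> dE t <= K * E t + e) ->
  E 0 = 0 -> E T <= e * T * exp (K * T).
Proof.
intros HK He HT Hc Hd Hle H0.
destruct (MVT_gen (fun t => E t * exp (- K * t)) 0 T
  (fun t => dE t * exp (- K * t) + E t * (- K * exp (- K * t)))) as [c [Hc1 Hc2]].
- rewrite Rmin_left, Rmax_right by lra. intros t Ht.
  apply (is_derive_mult E (fun t => exp (- K * t))).
  + apply Hd; lra.
  + auto_derive; [exact I | ring].
  + intros; apply Rmult_comm.
- intros t _. apply continuity_pt_filterlim.
  apply (continuous_mult E (fun t => exp (- K * t))); [apply Hc|].
  apply (ex_derive_continuous (fun t => exp (- K * t))). auto_derive. exact I.
- rewrite Rmin_left, Rmax_right in Hc1 by lra. rewrite H0 in Hc2.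
  specialize (Hle c Hc1).
  assert (Hexp : exp (- K * c) <= 1).
  { rewrite <- exp_0. destruct (Req_dec (K * c) 0) as [Z|Z].
    - replace (- K * c) with 0 by lra. lra.
    - left. apply exp_increasing. nra. }
  pose proof (exp_pos (- K * c)) as Hp. pose proof (exp_pos (K * T)) as HpT.
  assert (HI : exp (- K * T) * exp (K * T) = 1).
  { rewrite <- exp_plus, <- exp_0. f_equal. ring. }
  assert (Hb : E T * exp (- K * T) <= e * T).
  { assert (dE c * exp (- K * c) + E c * (- K * exp (- K * c)) <= e) by nra.
    nra. }
  replace (E T) with (E T * exp (- K * T) * exp (K * T))
    by (rewrite Rmult_assoc, HI; ring).
  apply Rmult_le_compat_r; lra.
Qed.

(** * The energy estimate *)

(* [2 eta eta_t] is the [x]-derivative of the flux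
   [2 eta eta_xx - eta_x^2 - 2 a eta^2], up to the term [2 a_x eta^2]. *)
Lemma energy_uniqueness (eta q q1 q2 a a1 : R -> R -> R) (T C K : R) :
  (forall x t, is_derive (fun y => eta y t) x (q x t)) ->
  (forall x t, is_derive (fun y => q y t) x (q1 x t)) ->
  (forall x t, is_derive (fun y => q1 y t) x (q2 x t)) ->
  (forall x t, is_derive (fun y => a y t) x (a1 x t)) ->
  cont2 eta -> cont2 q -> cont2 q2 -> cont2 a -> cont2 a1 ->
  (forall x t, 0 < t -> is_derive (eta x) t (q2 x t - 2 * (a x t * q x t))) ->
  0 < T ->
  (forall x t, 0 <= t <= T ->
     Rabs ((1 + x ^ 2) *
       (2 * (eta x t * q1 x t) - q x t ^ 2 - 2 * (a x t * eta x t ^ 2))) <= C) ->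
  (forall x t, 0 <= t <= T -> Rabs (a1 x t) <= K) ->
  (forall x, eta x 0 = 0) ->
  forall x, eta x T = 0.
Proof.
intros De Dq Dq1 Da Ce Cq Cq2 Ca Ca1 Dt HT HC HK H0.
set (B := fun x t => 2 * (eta x t * q1 x t) - q x t ^ 2 - 2 * (a x t * eta x t ^ 2)).
assert (HC0 : 0 <= C) by (eapply Rle_trans; [apply Rabs_pos | apply (HC 0 0); lra]).
assert (HK0 : 0 <= K) by (eapply Rle_trans; [apply Rabs_pos | apply (HK 0 0); lra]).
set (g := fun x t => 2 * (eta x t * (q2 x t - 2 * (a x t * q x t)))).
assert (Cg : cont2 g).
{ unfold g. repeat first [apply cont2_mult | apply cont2_minus |
    apply cont2_const | assumption]. }
assert (Csq : cont2 (fun x t => eta x t ^ 2)) by now apply cont2_pow.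
set (r := fun x t => 2 * (a1 x t * eta x t ^ 2)).
assert (Cr : cont2 r).
{ unfold r. repeat first [apply cont2_mult | apply cont2_const | assumption]. }
assert (DB : forall x t, is_derive (fun y => B y t) x (g x t - r x t)).
{ intros x t. unfold B, g, r.
  evar_last.
  - apply @is_derive_minus; [apply @is_derive_minus|].
    + apply is_derive_scal, @is_derive_mult; [apply De | apply Dq1 |].
      intros; apply Rmult_comm.
    + apply is_derive_pow, Dq.
    + apply is_derive_scal, @is_derive_mult;
        [apply Da | apply is_derive_pow, De |].
      intros; apply Rmult_comm.
  - unfold plus, minus, opp, mult; simpl; unfold plus, opp, mult; simpl; ring. }
(* At the endpoints the weight [1 + L ^ 2] is at least [L], which is all the decay that is
   needed. *)
assert (HB : forall L x t, 1 <= L -> x ^ 2 = L ^ 2 -> 0 <= t <= T ->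
  Rabs (B x t) <= C / L).
{ intros L x t HL Hx Ht. specialize (HC x t Ht). fold (B x t) in HC.
  rewrite Rabs_mult, (Rabs_pos_eq (1 + x ^ 2)) in HC by nra.
  apply Rmult_le_reg_l with L; [lra|].
  replace (L * (C / L)) with C by (field; lra).
  pose proof (Rabs_pos (B x t)). nra. }
(* Gronwall with rate [2 * K], from the term [2 a_x eta^2], and with error [2 * C / L], from the
   flux at the two endpoints. *)
assert (HE : forall L, 1 <= L ->
  RInt (fun x => eta x T ^ 2) (- L) L <= 2 * C / L * T * exp (2 * K * T)).
{ intros L HL.
  apply (gronwall (fun t => RInt (fun x => eta x t ^ 2) (- L) L)
           (fun t => RInt (fun x => g x t) (- L) L)); try lra.
  - apply Rmult_le_pos; [lra|]. left; apply Rinv_0_lt_compat; lra.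
  - intros t. apply (continuous_RInt_param (fun x t => eta x t ^ 2)). easy.
  - intros t Ht. apply (is_derive_RInt_time (fun x t => eta x t ^ 2) g); auto.
    intros x s Hs. unfold g. evar_last.
    + apply is_derive_pow. now apply Dt.
    + simpl; ring.
  - intros t Ht.
    assert (E1 : RInt (fun x => g x t - r x t) (- L) L = B L t - B (- L) t).
    { apply (RInt_of_derivative (fun x => B x t)); [intros; apply DB|].
      intros x. apply (cont2_space (fun x t => g x t - r x t)).
      now apply cont2_minus. }
    assert (E2 : RInt (fun x => g x t - r x t) (- L) L =
                 RInt (fun x => g x t) (- L) L - RInt (fun x => r x t) (- L) L).
    { apply (RInt_minus (V := R_CompleteNormedModule)
        (fun x => g x t) (fun x => r x t)); now apply cont2_ex_RInt. }
    assert (E3 : RInt (fun x => 2 * K * eta x t ^ 2) (- L) L =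
                 2 * K * RInt (fun x => eta x t ^ 2) (- L) L).
    { apply (RInt_scal (V := R_CompleteNormedModule) (fun x => eta x t ^ 2)).
      now apply (cont2_ex_RInt (fun x t => eta x t ^ 2)). }
    assert (Hr : RInt (fun x => r x t) (- L) L <=
                 RInt (fun x => 2 * K * eta x t ^ 2) (- L) L).
    { apply RInt_le; [lra | now apply cont2_ex_RInt | |].
      - apply (cont2_ex_RInt (fun x t => 2 * K * eta x t ^ 2)).
        apply cont2_mult; [apply cont2_const | exact Csq].
      - intros x _. unfold r. specialize (HK x t Ht).
        apply Rabs_le_between in HK. pose proof (pow2_ge_0 (eta x t)). nra. }
    pose proof (HB L L t HL eq_refl Ht) as B1.
    pose proof (HB L (- L) t HL ltac:(ring) Ht) as B2.
    apply Rabs_le_between in B1. apply Rabs_le_between in B2.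
    unfold Rdiv in *. lra.
  - rewrite (RInt_ext _ (fun _ => 0)) by (intros; rewrite H0; apply Rmult_0_l).
    rewrite RInt_const. apply Rmult_0_r. }
assert (Hsq : forall x, eta x T ^ 2 = 0).
{ apply nonneg_RInt_zero.
  - intros x. now apply (cont2_space (fun x t => eta x t ^ 2)).
  - intros; apply pow2_ge_0.
  - intros L HL. set (I := RInt (fun x => eta x T ^ 2) (- L) L).
    set (A := 2 * C * T * exp (2 * K * T)).
    apply Rnot_lt_le. intros HI.
    (* The energy grows with the segment, so [I] is at most [A / L']; a positive [I] contradicts
       this once [L'] exceeds [A / I]. *)
    set (L' := Rmax L (A / I + 1)).
    assert (HL' : 1 <= L') by (unfold L'; pose proof (Rmax_l L (A / I + 1)); lra).
    assert (HLL : L <= L') by apply Rmax_l.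
    assert (HIL : I <= RInt (fun x => eta x T ^ 2) (- L') L').
    { assert (Hex : forall a b, ex_RInt (fun x => eta x T ^ 2) a b).
      { intros; now apply (cont2_ex_RInt (fun x t => eta x t ^ 2)). }
      pose proof (RInt_Chasles _ (- L') (- L) L' (Hex _ _) (Hex _ _)) as E1.
      pose proof (RInt_Chasles _ (- L) L L' (Hex _ _) (Hex _ _)) as E2.
      unfold plus in E1, E2; simpl in E1, E2.
      assert (P1 : 0 <= RInt (fun x => eta x T ^ 2) (- L') (- L)).
      { apply RInt_ge_0; [lra | apply Hex | intros; apply pow2_ge_0]. }
      assert (P2 : 0 <= RInt (fun x => eta x T ^ 2) L L').
      { apply RInt_ge_0; [lra | apply Hex | intros; apply pow2_ge_0]. }
      unfold I. simpl in *. lra. }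
    specialize (HE L' HL').
    assert (HA : I * L' <= A).
    { apply Rle_trans with (2 * C / L' * T * exp (2 * K * T) * L').
      - apply Rmult_le_compat_r; lra.
      - right. unfold A. field. lra. }
    assert (HA' : I * (A / I + 1) <= I * L').
    { apply Rmult_le_compat_l; [lra | apply Rmax_r]. }
    replace (I * (A / I + 1)) with (A + I) in HA' by (field; lra). lra. }
intros x. specialize (Hsq x). nra.
Qed.

(** * Boundedness on a time strip *)

Definition bnd (T : R) (f : R -> R -> R) : Prop :=
  exists C, forall x t, 0 <= t <= T -> Rabs (f x t) <= C.

Lemma bnd_ext (T : R) (f g : R -> R -> R) :
  (forall x t, f x t = g x t) -> bnd T f -> bnd T g.
Proof. intros H [C HC]. exists C. intros x t Ht. rewrite <- H. now apply HC. Qed.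

Lemma bnd_const (T c : R) : bnd T (fun _ _ => c).
Proof. exists (Rabs c). intros; lra. Qed.

Lemma bnd_plus (T : R) (f g : R -> R -> R) :
  bnd T f -> bnd T g -> bnd T (fun x t => f x t + g x t).
Proof.
intros [C HC] [D HD]. exists (C + D). intros x t Ht.
eapply Rle_trans; [apply Rabs_triang|]. apply Rplus_le_compat; auto.
Qed.

Lemma bnd_mult (T : R) (f g : R -> R -> R) :
  bnd T f -> bnd T g -> bnd T (fun x t => f x t * g x t).
Proof.
intros [C HC] [D HD]. exists (C * D). intros x t Ht.
rewrite Rabs_mult. apply Rmult_le_compat; auto using Rabs_pos.
Qed.

Lemma bnd_minus (T : R) (f g : R -> R -> R) :
  bnd T f -> bnd T g -> bnd T (fun x t => f x t - g x t).
Proof.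
intros Hf Hg. apply bnd_ext with (fun x t => f x t + -1 * g x t).
- intros; ring.
- apply bnd_plus; [exact Hf|]. apply (bnd_mult T (fun _ _ => -1)); [|exact Hg].
  apply bnd_const.
Qed.

(** Hypotheses are tried before products are split, so that a weighted factor [(1 + x ^ 2) * f],
    whose weight alone is unbounded, is closed as a whole. The products below are bracketed
    accordingly. *)
Ltac bounded :=
  repeat first [apply bnd_const |
                solve [match goal with H : _ |- _ => apply H end] |
                apply bnd_minus | apply bnd_plus | apply bnd_mult].

(** * Spatial derivatives along a curve in the space *)

(* [D_x^n u], frozen at its value at [t = 0] for [t < 0], so that no endpoint
   has to be treated separately. *)
Definition jet (u : R -> R -> R) (n : nat) (x t : R) : R :=
  Derive_n (slice u (Rmax 0 t)) n x.

Lemma jet_pos (u : R -> R -> R) (n : nat) (x t : R) :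
  0 <= t -> jet u n x t = Derive_n (slice u t) n x.
Proof. intros Ht. unfold jet. now rewrite Rmax_right. Qed.

Lemma is_derive_jet (M : fspace) (u : R -> R -> R) (n : nat) (x t : R) :
  curve M u -> is_derive (fun y => jet u n y t) x (jet u (S n) x t).
Proof.
intros [Hu _]. apply Derive_correct.
exact (proj1 (Hu (Rmax 0 t) (Rmax_l 0 t)) (S n) x).
Qed.

(** Continuity of the curve bounds the seminorm near each time, and compactness of [[0, T]] makes
    the bound uniform. *)
Lemma jet_seminorm (M : fspace) (u : R -> R -> R) (k n : nat) (T : R) :
  curve M u -> M k n -> bnd T (fun x t => x ^ k * jet u n x t).
Proof.
intros [Hu Hc] Hkn.
(* The bound is written [/ d], so that decreasing [d] weakens the property. *)
destruct (uniform_on_segment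
  (fun d s => forall x, Rabs (x ^ k * Derive_n (slice u s) n x) <= / d) 0 T)
  as [d [Hd HP]].
- intros s d d' Hd' Hle H x. eapply Rle_trans; [apply H|].
  now apply Rinv_le_contravar.
- intros t Ht. destruct (proj2 (Hu t (proj1 Ht)) k n Hkn) as [C HC].
  destruct (Hc k n Hkn t (proj1 Ht) 1 Rlt_0_1) as [d [Hd Hs]].
  assert (HC0 : 0 <= C) by (eapply Rle_trans; [apply Rabs_pos | apply (HC 0)]).
  assert (Hi : 0 < / (C + 1)) by (apply Rinv_0_lt_compat; lra).
  exists (Rmin d (/ (C + 1))). split; [now apply Rmin_glb_lt|].
  intros s Hs0 Hst x.
  apply Rle_trans with (C + 1).
  + replace (x ^ k * Derive_n (slice u s) n x) with
      (x ^ k * Derive_n (slice u t) n x +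
       x ^ k * (Derive_n (slice u s) n x - Derive_n (slice u t) n x)) by ring.
    eapply Rle_trans; [apply Rabs_triang|]. apply Rplus_le_compat; [apply HC|].
    apply Hs; [apply Hs0|]. eapply Rlt_le_trans; [exact Hst | apply Rmin_l].
  + rewrite <- (Rinv_inv (C + 1)) at 1.
    apply Rinv_le_contravar; [now apply Rmin_glb_lt | apply Rmin_r].
- exists (/ d). intros x t Ht. rewrite jet_pos by apply Ht. now apply HP.
Qed.

Lemma bnd_jet (M : fspace) (u : R -> R -> R) (n : nat) (T : R) :
  curve M u -> M 0%nat n -> bnd T (jet u n).
Proof.
intros Hu Hn. apply bnd_ext with (fun x t => x ^ 0 * jet u n x t).
- intros; simpl; ring.
- now apply jet_seminorm with M.
Qed.

Lemma bnd_weighted_jet (M : fspace) (u : R -> R -> R) (n : nat) (T : R) :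
  curve M u -> M 0%nat n -> M 2%nat n -> bnd T (fun x t => (1 + x ^ 2) * jet u n x t).
Proof.
intros Hu H0 H2.
apply bnd_ext with (fun x t => jet u n x t + x ^ 2 * jet u n x t).
- intros; ring.
- apply bnd_plus; [now apply bnd_jet with M | now apply jet_seminorm with M].
Qed.

Lemma Rmax_0_contraction (s t : R) : Rabs (Rmax 0 s - Rmax 0 t) <= Rabs (s - t).
Proof. unfold Rmax, Rabs; repeat destruct Rle_dec; repeat destruct Rcase_abs; lra. Qed.

Lemma continuous_jet_time (M : fspace) (u : R -> R -> R) (n : nat) (x t : R) :
  curve M u -> M 0%nat n -> continuous (jet u n x) t.
Proof.
intros [_ Hc] Hn. apply continuity_pt_filterlim. intros e He.
destruct (Hc 0%nat n Hn (Rmax 0 t) (Rmax_l 0 t) (e / 2)) as [d [Hd Hs]]; [lra|].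
exists d; split; [exact Hd|]. intros s [_ Hst]. simpl in *. unfold R_dist in *.
specialize (Hs (Rmax 0 s) (Rmax_l 0 s)
  (Rle_lt_trans _ _ _ (Rmax_0_contraction s t) Hst) x).
rewrite Rmult_1_l in Hs. unfold jet. lra.
Qed.

Lemma cont2_jet (M : fspace) (u : R -> R -> R) (n : nat) :
  curve M u -> (forall n, M 0%nat n) -> cont2 (jet u n).
Proof.
intros Hu HM. apply cont2_of_bounded_derivative with (jet u (S n)).
- intros; now apply is_derive_jet with M.
- intros T. destruct (bnd_jet M u (S n) (Rmax 0 T) Hu (HM _)) as [C HC].
  exists C. intros x t Ht. replace (jet u (S n) x t) with (jet u (S n) x (Rmax 0 t)).
  (* Jets are constant in time for [t <= 0], so a bound on [[0, Rmax 0 T]] holds for all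
     [t <= T]. *)
  + apply HC. split; [apply Rmax_l|]. now apply Rle_max_compat_l.
  + unfold jet. now rewrite (Rmax_right 0 (Rmax 0 t)) by apply Rmax_l.
- intros; now apply continuous_jet_time with M.
Qed.

Lemma is_derive_jet_time (M : fspace) (E : evolution) (u : R -> R -> R) (x t : R) :
  solution M E u -> 0 < t -> is_derive (jet u 0 x) t (rhs E (slice u t) x).
Proof.
intros [_ [_ Hu]] Ht. apply is_derive_ext_loc with (fun s => u x s); [|now apply Hu].
assert (Hloc : locally t (fun s => 0 < s)) by (apply open_gt; exact Ht).
revert Hloc. apply filter_imp. intros s Hs. now rewrite jet_pos by lra.
Qed.

Lemma source_jet_time (M : fspace) (w : R -> R -> R) (x t : R) :
  solution M cole_hopf_source w -> 0 < t ->
  is_derive (jet w 0 x) t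
    (jet w 3 x t - 3 * (jet w 1 x t * jet w 2 x t / jet w 0 x t)).
Proof.
intros Hw Ht. rewrite !jet_pos by lra.
exact (is_derive_jet_time M cole_hopf_source w x t Hw Ht).
Qed.

Lemma mkdv_jet_time (M : fspace) (v : R -> R -> R) (x t : R) :
  solution M mkdv v -> 0 < t ->
  is_derive (jet v 0 x) t (jet v 3 x t - 6 * jet v 0 x t ^ 2 * jet v 1 x t).
Proof.
intros Hv Ht. rewrite !jet_pos by lra.
exact (is_derive_jet_time M mkdv v x t Hv Ht).
Qed.

(** * Keeping [w] away from zero *)

(** The logarithm of [w ^ 2] has derivative [2 * v], which is integrable, so it stays within [4 * C]
    of its value at 0. Squaring covers both signs of [w]. *)
Lemma cole_hopf_lower_bound (w v : R -> R) (C : R) :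
  (forall x, is_derive w x (v x * w x)) -> (forall x, w x <> 0) ->
  (forall x, Rabs ((1 + x ^ 2) * v x) <= C) ->
  exists m, 0 < m /\ forall x, m <= w x ^ 2.
Proof.
intros Hd H0 HC.
assert (Hp : forall x, 0 < w x ^ 2) by (intros; now apply pow2_gt_0).
exists (exp (ln (w 0 ^ 2) - 2 * (2 * C))). split; [apply exp_pos|].
intros x.
assert (Hb : Rabs (ln (w x ^ 2) - ln (w 0 ^ 2)) <= 2 * (2 * C)).
{ apply (bounded_of_integrable_derivative (fun x => ln (w x ^ 2)) (fun x => 2 * v x)).
  - intros y. evar_last.
    + apply (is_derive_comp ln (fun y => w y ^ 2)).
      * now apply is_derive_ln.
      * apply is_derive_pow, Hd.
    + unfold scal; simpl; unfold mult; simpl. field. apply H0.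
  - intros y. replace ((1 + y ^ 2) * (2 * v y)) with (2 * ((1 + y ^ 2) * v y)) by ring.
    rewrite Rabs_mult, (Rabs_pos_eq 2) by lra. specialize (HC y). lra. }
apply Rabs_le_between in Hb.
rewrite <- (exp_ln (w x ^ 2)) by apply Hp.
apply Rnot_lt_le. intros Hlt. apply exp_lt_inv in Hlt. lra.
Qed.

Lemma positive_min (f : R -> R) (a b : R) :
  a <= b -> (forall x, continuous f x) -> (forall x, 0 < f x) ->
  exists m, 0 < m /\ forall x, a <= x <= b -> m <= f x.
Proof.
intros Hab Hc Hp. destruct (continuity_ab_min f a b Hab) as [y [Hy _]].
- intros c _. apply continuity_pt_filterlim, Hc.
- now exists (f y).
Qed.

Lemma bnd_of_continuous (f : R -> R) (T : R) :
  0 <= T -> (forall t, continuous f t) -> bnd T (fun _ t => f t).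
Proof.
intros HT Hc. destruct (continuity_ab_maj (fun t => Rabs (f t)) 0 T HT) as [y [Hy _]].
- intros c _. apply continuity_pt_filterlim.
  apply (continuous_comp f Rabs); [apply Hc | apply continuous_Rabs].
- exists (Rabs (f y)). intros _ t Ht. now apply Hy.
Qed.

(* [(w^2)_t = 2 w w_xxx - 6 w_x w_xx] involves no division by [w], hence decays
   in [x] uniformly in [t]: the limits of [w^2] at infinity are conserved. *)
Lemma source_lower_bound (M : fspace) (w : R -> R -> R) (T m0 : R) :
  (forall n, M 0%nat n) -> (forall n, (1 <= n)%nat -> M 2%nat n) ->
  solution M cole_hopf_source w -> 0 < T ->
  0 < m0 -> (forall x, m0 <= jet w 0 x 0 ^ 2) ->
  exists m, 0 < m /\ forall t, 0 <= t <= T -> forall x, m <= Rabs (jet w 0 x t).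
Proof.
intros HM0 HM2 Hsol HT Hm0 Hinit. pose proof (proj1 Hsol) as Hcv.
assert (Hnz : forall x t, jet w 0 x t <> 0).
{ intros x t. exact (proj1 (proj2 Hsol) (Rmax 0 t) (Rmax_l 0 t) x). }
assert (Hb : forall n, bnd T (jet w n)) by (intros; now apply bnd_jet with M).
assert (Hwb : forall n, bnd T (fun x t => (1 + x ^ 2) * jet w (S n) x t)).
{ intros; apply bnd_weighted_jet with M; auto. apply HM2; lia. }
assert (Hct : forall x t, continuous (jet w 0 x) t).
{ intros; now apply continuous_jet_time with M. }
assert (Hcx : forall t x, continuous (fun y => jet w 0 y t) x).
{ intros t x. apply cont2_space. now apply cont2_jet with M. }
set (h := fun x t => 2 * jet w 0 x t * jet w 3 x t - 6 * jet w 1 x t * jet w 2 x t).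
assert (Dw : forall x t, 0 < t -> is_derive (fun s => jet w 0 x s ^ 2) t (h x t)).
{ intros x t Ht. evar_last.
  - apply is_derive_pow. now apply source_jet_time with M.
  - unfold h. simpl. field. apply Hnz. }
assert (Hh : bnd T (fun x t => (1 + x ^ 2) * h x t)).
{ apply bnd_ext with (fun x t => 2 * jet w 0 x t * ((1 + x ^ 2) * jet w 3 x t)
      - 6 * jet w 1 x t * ((1 + x ^ 2) * jet w 2 x t)).
  - intros x t. unfold h. ring.
  - bounded. }
destruct Hh as [C HC].
(* The mean value theorem in time, at fixed [x], multiplied by the weight: [w ^ 2] loses at most
   [C * T / (1 + x ^ 2)]. *)
assert (Hdiff : forall x t, 0 <= t <= T ->
  (1 + x ^ 2) * (jet w 0 x 0 ^ 2 - jet w 0 x t ^ 2) <= C * T).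
{ intros x t Ht.
  destruct (MVT_gen (fun s => jet w 0 x s ^ 2) 0 t (h x)) as [c [Hc1 Hc2]].
  - rewrite Rmin_left, Rmax_right by lra. intros s Hs. now apply Dw.
  - intros s _. apply continuity_pt_filterlim.
    apply (continuous_mult (jet w 0 x) (fun s => jet w 0 x s ^ 1)); [apply Hct|].
    apply (continuous_mult (jet w 0 x) (fun s => 1)); [apply Hct|].
    apply continuous_const.
  - rewrite Rmin_left, Rmax_right in Hc1 by lra.
    specialize (HC x c ltac:(lra)). apply Rabs_le_between in HC.
    replace ((1 + x ^ 2) * (jet w 0 x 0 ^ 2 - jet w 0 x t ^ 2))
      with (- ((1 + x ^ 2) * h x c) * t) by nra.
    nra. }
destruct (uniform_on_segment (fun d s => forall x, d <= Rabs (jet w 0 x s)) 0 T)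
  as [m Hm]; [| |now exists m].
- intros s d d' _ Hle H x. specialize (H x). lra.
(* Beyond [X] the weight exceeds [A], so at most half of [m0] is lost; on [[- X, X]] a positive
   minimum exists. *)
- intros t Ht. set (A := 2 * (C * T) / m0).
  set (X := Rabs A + 1).
  assert (HX : 1 <= X) by (unfold X; pose proof (Rabs_pos A); lra).
  destruct (positive_min (fun x => Rabs (jet w 0 x t)) (- X) X) as [m1 [Hm1 Hin]].
  { lra. }
  { intros x. apply (continuous_comp (fun y => jet w 0 y t) Rabs); [apply Hcx|].
    apply continuous_Rabs. }
  { intros x. now apply Rabs_pos_lt. }
  assert (Hout : forall x, X < Rabs x -> m0 / 2 <= Rabs (jet w 0 x t) ^ 2).
  { intros x Hx. rewrite pow2_abs. specialize (Hdiff x t Ht). specialize (Hinit x).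
    assert (HA : A <= 1 + x ^ 2).
    { rewrite <- pow2_abs. pose proof (Rle_abs A). unfold X in *. nra. }
    assert (HAm : A * m0 = 2 * (C * T)) by (unfold A; field; lra).
    assert (Hle : (1 + x ^ 2) * (jet w 0 x 0 ^ 2 - jet w 0 x t ^ 2) <=
                  (1 + x ^ 2) * (m0 / 2)) by nra.
    apply Rmult_le_reg_l in Hle; nra. }
  (* The bound outside concerns the square: [mu <= 1] gives [mu ^ 2 <= mu <= m0 / 2], hence [mu]
     bounds [Rabs w] there too. *)
  set (mu := Rmin m1 (Rmin 1 (m0 / 2))).
  assert (Hmu : 0 < mu) by (unfold mu; repeat apply Rmin_glb_lt; lra).
  assert (Hmu1 : mu <= m1) by apply Rmin_l.
  assert (Hmu2 : mu <= 1) by (eapply Rle_trans; [apply Rmin_r | apply Rmin_l]).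
  assert (Hmu3 : mu <= m0 / 2) by (eapply Rle_trans; [apply Rmin_r | apply Rmin_r]).
  assert (Hall : forall x, mu <= Rabs (jet w 0 x t)).
  { intros x. destruct (Rle_dec (Rabs x) X) as [Hx|Hx].
    - apply Rabs_le_between in Hx. specialize (Hin x Hx). simpl in Hin. lra.
    - specialize (Hout x ltac:(lra)). pose proof (Rabs_pos (jet w 0 x t)). nra. }
  (* Continuity in the sup norm carries half of the bound at time [t] to nearby times. *)
  destruct (proj2 Hcv 0%nat 0%nat (HM0 _) t (proj1 Ht) (mu / 2)) as [d [Hd Hs]]; [lra|].
  exists (Rmin d (mu / 2)). split; [apply Rmin_glb_lt; lra|].
  intros s Hs0 Hst x. apply Rle_trans with (mu / 2); [apply Rmin_r|].
  specialize (Hs s (proj1 Hs0) (Rlt_le_trans _ _ _ Hst (Rmin_l _ _)) x).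
  rewrite <- !jet_pos, Rmult_1_l in Hs by lra.
  specialize (Hall x). pose proof (Rabs_triang_inv (jet w 0 x t) (jet w 0 x s)) as Htr.
  rewrite Rabs_minus_sym in Htr. lra.
Qed.

(** * A potential for mKdV *)

Ltac continuity2 :=
  repeat first [apply cont2_const |
                solve [match goal with H : _ |- _ => apply H end] |
                apply cont2_pow | apply cont2_minus | apply cont2_plus |
                apply cont2_mult].

(** The second integral fixes the constant of integration at [x = 0], so that the time derivative is
    the flux itself, with no additional function of [t]. *)
Definition mkdv_potential (v : R -> R -> R) (x t : R) : R :=
  RInt (fun y => jet v 0 y t) 0 x +
  RInt (fun s => jet v 2 0 s - 2 * jet v 0 0 s ^ 3) 0 t.

Lemma is_derive_potential (M : fspace) (v : R -> R -> R) (x t : R) :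
  curve M v -> (forall n, M 0%nat n) ->
  is_derive (fun y => mkdv_potential v y t) x (jet v 0 x t).
Proof.
intros Hv HM. evar_last.
- apply @is_derive_plus; [|apply @is_derive_const].
  apply (is_derive_RInt_upper (fun y => jet v 0 y t)).
  intros y. apply cont2_space. now apply cont2_jet with M.
- apply plus_zero_r.
Qed.

Lemma continuous_potential_source (M : fspace) (v : R -> R -> R) (s : R) :
  curve M v -> (forall n, M 0%nat n) ->
  continuous (fun s => jet v 2 0 s - 2 * jet v 0 0 s ^ 3) s.
Proof.
intros Hv HM. apply (cont2_time (fun x s => jet v 2 x s - 2 * jet v 0 x s ^ 3)).
assert (Cv : forall n, cont2 (jet v n)) by (intros; now apply cont2_jet with M).
continuity2.
Qed.

(* mKdV is a conservation law: [v_t = (v_xx - 2 v^3)_x]. *)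
Lemma is_derive_potential_time (M : fspace) (v : R -> R -> R) (x t : R) :
  solution M mkdv v -> (forall n, M 0%nat n) -> 0 < t ->
  is_derive (mkdv_potential v x) t (jet v 2 x t - 2 * jet v 0 x t ^ 3).
Proof.
intros Hsol HM Ht. pose proof (proj1 Hsol) as Hv.
assert (Cv : forall n, cont2 (jet v n)) by (intros; now apply cont2_jet with M).
set (g := fun x t => jet v 3 x t - 6 * jet v 0 x t ^ 2 * jet v 1 x t).
assert (Cg : cont2 g) by (unfold g; continuity2).
(* The flux at [x = 0] that appears here is cancelled by the derivative of the second integral. *)
assert (E : RInt (fun y => g y t) 0 x =
  (jet v 2 x t - 2 * jet v 0 x t ^ 3) - (jet v 2 0 t - 2 * jet v 0 0 t ^ 3)).
{ apply (RInt_of_derivative (fun y => jet v 2 y t - 2 * jet v 0 y t ^ 3)).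
  - intros y. evar_last.
    + apply @is_derive_minus; [now apply is_derive_jet with M|].
      apply is_derive_scal, is_derive_pow. now apply is_derive_jet with M.
    + unfold g, minus, plus, opp; simpl. ring.
  - intros y. now apply cont2_space. }
unfold mkdv_potential. evar_last.
- apply @is_derive_plus.
  + apply (is_derive_RInt_time (jet v 0) g); [exact Ht | apply Cv | exact Cg|].
    intros y s Hs. now apply mkdv_jet_time with M.
  + apply (is_derive_RInt_upper (fun s => jet v 2 0 s - 2 * jet v 0 0 s ^ 3)).
    intros s. now apply continuous_potential_source with M.
- rewrite E. unfold plus; simpl. ring.
Qed.

Lemma cont2_potential (M : fspace) (v : R -> R -> R) :
  curve M v -> (forall n, M 0%nat n) -> cont2 (mkdv_potential v).
Proof.
intros Hv HM.
assert (Cv : forall n, cont2 (jet v n)) by (intros; now apply cont2_jet with M).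
apply cont2_of_bounded_derivative with (jet v 0).
- intros. now apply is_derive_potential with M.
- intros T. destruct (bnd_jet M v 0 (Rmax 0 T) Hv (HM _)) as [C HC].
  exists C. intros x t Ht. replace (jet v 0 x t) with (jet v 0 x (Rmax 0 t)).
  + apply HC. split; [apply Rmax_l|]. now apply Rle_max_compat_l.
  + unfold jet. now rewrite (Rmax_right 0 (Rmax 0 t)) by apply Rmax_l.
- intros x t. apply (continuous_plus (V := R_NormedModule)).
  + now apply continuous_RInt_param.
  + apply (ex_derive_continuous
      (fun r => RInt (fun s => jet v 2 0 s - 2 * jet v 0 0 s ^ 3) 0 r)).
    eexists. apply (is_derive_RInt_upper (fun s => jet v 2 0 s - 2 * jet v 0 0 s ^ 3)).
    intros s. now apply continuous_potential_source with M.
Qed.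

(** * Uniqueness and the Cole-Hopf link *)

(** The conditions on [M] are common to both spaces: sup norms of all derivatives, and quadratic
    weights from the first derivative on. The latter make [p] decay, since [p] contains [w_x]. *)
Lemma cole_hopf_links (M : fspace) :
  (forall n, M 0%nat n) -> (forall n, (1 <= n)%nat -> M 2%nat n) ->
  linked M schwartz cole_hopf_source mkdv cole_hopf.
Proof.
intros HM0 HM2 w v Hw Hv Hinit T HT x0.
pose proof (proj1 Hw) as Hcw. pose proof (proj1 Hv) as Hcv.
assert (HS : forall k n, schwartz k n) by (intros; exact I).
assert (Hnz : forall x t, jet w 0 x t <> 0).
{ intros x t. exact (proj1 (proj2 Hw) (Rmax 0 t) (Rmax_l 0 t) x). }
assert (Dw : forall n x t, is_derive (fun y => jet w n y t) x (jet w (S n) x t)).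
{ intros; now apply is_derive_jet with M. }
assert (Dv : forall n x t, is_derive (fun y => jet v n y t) x (jet v (S n) x t)).
{ intros; now apply is_derive_jet with schwartz. }
assert (Cw : forall n, cont2 (jet w n)) by (intros; now apply cont2_jet with M).
assert (Cv : forall n, cont2 (jet v n)).
{ intros; now apply cont2_jet with schwartz. }
assert (Bw : forall n, bnd T (jet w n)) by (intros; now apply bnd_jet with M).
assert (Bv : forall n, bnd T (jet v n)).
{ intros; now apply bnd_jet with schwartz. }
assert (Bwe : forall n, bnd T (fun x t => (1 + x ^ 2) * jet w (S n) x t)).
{ intros; apply bnd_weighted_jet with M; auto. apply HM2; lia. }
assert (Bve : forall n, bnd T (fun x t => (1 + x ^ 2) * jet v n x t)).
{ intros; now apply bnd_weighted_jet with schwartz. }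
assert (Hch : forall x, jet w 1 x 0 = jet v 0 x 0 * jet w 0 x 0).
{ intros x. rewrite !jet_pos by lra. symmetry. apply Rminus_diag_uniq.
  exact (Hinit x). }
destruct (Bve 0%nat) as [Cv0 HCv0].
destruct (cole_hopf_lower_bound (fun x => jet w 0 x 0) (fun x => jet v 0 x 0) Cv0)
  as [m0 [Hm0 Hm0']].
{ intros x. rewrite <- Hch. apply Dw. }
{ intros; apply Hnz. }
{ intros x. apply HCv0. lra. }
destruct (source_lower_bound M w T m0) as [m [Hm Hm']]; auto.
(* With the inverse named, [p] and its derivatives are polynomials in jets and [J], within reach of
   [continuity2] and [bounded]. *)
set (J := fun x t => / jet w 0 x t).
assert (CJ : cont2 J) by (apply cont2_inv; auto).
assert (BJ : bnd T J).
{ exists (/ m). intros x t Ht. unfold J. rewrite Rabs_inv.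
  apply Rinv_le_contravar; [exact Hm | now apply Hm']. }
assert (DJ : forall x t, is_derive (fun y => J y t) x (- jet w 1 x t * J x t ^ 2)).
{ intros x t. unfold J. evar_last.
  - apply is_derive_inv; [apply Dw | apply Hnz].
  - simpl. field. apply Hnz. }
set (p := fun x t => jet w 1 x t * J x t).
set (p1 := fun x t => jet w 2 x t * J x t - p x t ^ 2).
set (p2 := fun x t => jet w 3 x t * J x t
                      - 3 * (jet w 1 x t * jet w 2 x t * J x t ^ 2) + 2 * p x t ^ 3).
assert (Dp : forall x t, is_derive (fun y => p y t) x (p1 x t)).
{ intros x t. unfold p. evar_last.
  - apply @is_derive_mult; [apply Dw | apply DJ | intros; apply Rmult_comm].
  - unfold p1, p, plus, mult; simpl. ring. }
assert (Dp1 : forall x t, is_derive (fun y => p1 y t) x (p2 x t)).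
{ intros x t. unfold p1. evar_last.
  - apply @is_derive_minus; [|apply is_derive_pow, Dp].
    apply @is_derive_mult; [apply Dw | apply DJ | intros; apply Rmult_comm].
  - unfold p2, p1, p, minus, plus, opp, mult; simpl. ring. }
(* The vanishing of [q] is the claim. The coefficient [a] comes from [v^3 - p^3 = a q]. *)
set (q := fun x t => jet v 0 x t - p x t).
set (q1 := fun x t => jet v 1 x t - p1 x t).
set (q2 := fun x t => jet v 2 x t - p2 x t).
set (a := fun x t => jet v 0 x t ^ 2 + jet v 0 x t * p x t + p x t ^ 2).
set (a1 := fun x t => 2 * (jet v 0 x t * jet v 1 x t)
    + (jet v 1 x t * p x t + jet v 0 x t * p1 x t) + 2 * (p x t * p1 x t)).
assert (Cp : cont2 p) by (unfold p; continuity2).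
assert (Cp1 : cont2 p1) by (unfold p1; continuity2).
assert (Cp2 : cont2 p2) by (unfold p2; continuity2).
assert (Bp : bnd T p) by (unfold p; bounded).
assert (Bp1 : bnd T p1) by (unfold p1; simpl; bounded).
assert (Bpe : bnd T (fun x t => (1 + x ^ 2) * p x t)).
{ apply bnd_ext with (fun x t => (1 + x ^ 2) * jet w 1 x t * J x t).
  - intros; unfold p; ring.
  - bounded. }
assert (Bqe : bnd T (fun x t => (1 + x ^ 2) * q x t)).
{ apply bnd_ext with (fun x t => (1 + x ^ 2) * jet v 0 x t - (1 + x ^ 2) * p x t).
  - intros; unfold q; ring.
  - bounded. }
assert (Bq1e : bnd T (fun x t => (1 + x ^ 2) * q1 x t)).
{ apply bnd_ext with (fun x t => (1 + x ^ 2) * jet v 1 x t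
    - ((1 + x ^ 2) * jet w 2 x t * J x t - (1 + x ^ 2) * p x t * p x t)).
  - intros; unfold q1, p1; ring.
  - bounded. }
assert (Bae : bnd T (fun x t => (1 + x ^ 2) * a x t)).
{ apply bnd_ext with (fun x t => (1 + x ^ 2) * jet v 0 x t * jet v 0 x t
    + (1 + x ^ 2) * jet v 0 x t * p x t + (1 + x ^ 2) * p x t * p x t).
  - intros; unfold a; ring.
  - bounded. }
assert (Bq : bnd T q) by (unfold q; bounded).
assert (Ba1 : bnd T a1) by (unfold a1; bounded).
(* Half the logarithm of [w ^ 2] is a primitive of [p], whatever the sign of [w]; hence [eta] is a
   primitive of [q]. *)
set (eta0 := fun x t => mkdv_potential v x t - / 2 * ln (jet w 0 x t ^ 2)).
set (eta := fun x t => eta0 x t - eta0 0 0).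
assert (Hsq : forall x t, 0 < jet w 0 x t ^ 2) by (intros; now apply pow2_gt_0).
assert (Deta0 : forall x t, is_derive (fun y => eta0 y t) x (q x t)).
{ intros x t. unfold eta0. evar_last.
  - apply @is_derive_minus; [now apply is_derive_potential with schwartz|].
    apply is_derive_scal, (is_derive_comp ln (fun y => jet w 0 y t ^ 2)).
    + now apply is_derive_ln.
    + apply is_derive_pow, Dw.
  - unfold q, p, J, minus, plus, opp, scal; simpl; unfold mult; simpl.
    field. apply Hnz. }
assert (Deta : forall x t, is_derive (fun y => eta y t) x (q x t)).
{ intros x t. unfold eta. evar_last.
  - apply @is_derive_minus; [apply Deta0 | apply @is_derive_const].
  - unfold minus, plus, opp, zero; simpl. ring. }
assert (Cln : cont2 (fun x t => ln (jet w 0 x t ^ 2))).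
{ intros x t. apply (continuity_1d_2d_pt_comp ln (fun x t => jet w 0 x t ^ 2)).
  - apply continuity_pt_filterlim, (ex_derive_continuous ln).
    eexists. now apply is_derive_ln.
  - now apply cont2_pow. }
assert (Ceta : cont2 eta).
{ unfold eta, eta0. pose proof (cont2_potential schwartz v Hcv (HS 0%nat)).
  continuity2. }
(* At time 0 the hypothesis gives [q = 0], so the integrable-derivative bound applies with constant
   0. *)
assert (Heta0 : forall x, eta x 0 = 0).
{ assert (H00 : eta 0 0 = 0) by apply Rminus_diag.
  intros x. assert (Hb : Rabs (eta x 0 - eta 0 0) <= 2 * 0).
  { apply (bounded_of_integrable_derivative (fun x => eta x 0) (fun x => q x 0)).
    - intros; apply Deta.
    - intros y. replace (q y 0) with 0.
      + rewrite Rmult_0_r, Rabs_R0. lra.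
      + unfold q, p, J. rewrite Hch. field. apply Hnz. }
  rewrite H00, Rmult_0_r in Hb. apply Rabs_le_between in Hb. lra. }
(* The variation in [x] is bounded by the decay of [q], and the value at [x = 0] by continuity in
   time. *)
assert (Beta : bnd T eta).
{ apply bnd_ext with (fun x t => (eta x t - eta 0 t) + eta 0 t); [intros; ring|].
  apply bnd_plus.
  - destruct Bqe as [C HC]. exists (2 * C). intros x t Ht.
    apply (bounded_of_integrable_derivative (fun x => eta x t) (fun x => q x t)).
    + intros; apply Deta.
    + intros y. now apply HC.
  - apply bnd_of_continuous; [lra|]. intros; now apply cont2_time. }
(* The equation for [w] gives [w_t / w = p_xx - 2 p^3]; subtracting this from [V_t = v_xx - 2 v^3]
   leaves [q_xx - 2 a q]. *)
assert (Dtime : forall x t, 0 < t ->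
  is_derive (eta x) t (q2 x t - 2 * (a x t * q x t))).
{ intros x t Ht. unfold eta, eta0. evar_last.
  - apply @is_derive_minus; [|apply @is_derive_const].
    apply @is_derive_minus; [now apply (is_derive_potential_time schwartz)|].
    apply is_derive_scal, (is_derive_comp ln (fun s => jet w 0 x s ^ 2)).
    + now apply is_derive_ln.
    + apply is_derive_pow. now apply source_jet_time with M.
  - unfold q2, p2, a, q, p, J, minus, plus, opp, zero, scal; simpl;
      unfold mult; simpl.
    field. apply Hnz. }
(* Each term has one factor that absorbs the weight, namely [q1], [q] or [a]; [eta] only needs to be
   bounded. *)
assert (BB : bnd T (fun x t => (1 + x ^ 2) *
  (2 * (eta x t * q1 x t) - q x t ^ 2 - 2 * (a x t * eta x t ^ 2)))).
{ apply bnd_ext with (fun x t => 2 * (eta x t * ((1 + x ^ 2) * q1 x t))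
    - (1 + x ^ 2) * q x t * q x t
    - 2 * ((1 + x ^ 2) * a x t * (eta x t * eta x t))).
  - intros; ring.
  - bounded. }
destruct BB as [C HC]. destruct Ba1 as [K HK].
assert (Hz : forall x, eta x T = 0).
{ apply (energy_uniqueness eta q q1 q2 a a1 T C K); auto.
  - intros x t. unfold q. apply @is_derive_minus; [apply Dv | apply Dp].
  - intros x t. unfold q1. apply @is_derive_minus; [apply Dv | apply Dp1].
  - intros x t. unfold a, a1. evar_last.
    + apply @is_derive_plus; [apply @is_derive_plus|].
      * apply is_derive_pow, Dv.
      * apply @is_derive_mult; [apply Dv | apply Dp | intros; apply Rmult_comm].
      * apply is_derive_pow, Dp.
    + unfold plus, mult; simpl. ring.
  - unfold q; continuity2.
  - unfold q2; continuity2.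
  - unfold a; continuity2.
  - unfold a1; continuity2. }
assert (Hq : q x0 T = 0).
{ transitivity (Derive (fun y => eta y T) x0).
  - symmetry. apply is_derive_unique, Deta.
  - rewrite (Derive_ext (fun y => eta y T) (fun _ => 0) x0 Hz).
    apply Derive_const. }
assert (Hgoal : jet v 0 x0 T * jet w 0 x0 T - jet w 1 x0 T = 0).
{ replace (jet v 0 x0 T) with (p x0 T) by (unfold q in Hq; lra).
  unfold p, J. field. apply Hnz. }
rewrite !jet_pos in Hgoal by lra. exact Hgoal.
Qed.

Theorem proposition1 :
  linked schwartz schwartz cole_hopf_source mkdv cole_hopf /\
  linked schwartz_derivative schwartz cole_hopf_source mkdv cole_hopf.
Proof.
split; apply cole_hopf_links; intros; unfold schwartz, schwartz_derivative; auto.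
Qed.
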